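(* Let $N\ge2$, $K\in\mathcal K^{ss}_{(o)}$, $u\in C_c^\infty(\mathbb R^N\setminus\{o\})$ and $a,b\in\mathbb R$. Then $$\int_{\mathbb R^N}\frac{\max\{\|\nabla u\|_{K^*}^2,\|-\nabla u\|_{K^*}^2\}}{\|x\|_K^{2b}}dx+\int_{\mathbb R^N}\frac{u^2}{\|x\|_K^{2a}}dx\ \ge\ C_{ckn1}(N,a,b)\int_{\mathbb R^N}\frac{u^2}{\|x\|_K^{a+b+1}}dx,$$ where $C_{ckn1}(N,a,b)=|N-a-b-1|$ if $(a,b)\in\mathcal A$, $C_{ckn1}(N,a,b)=|N-3b+a-3|$ if $(a,b)\in\mathcal B$, and, when $a=b+1$, $C_{ckn1}(N,b+1,b)=1+\frac{(N-2b-2)^2}{4}$. Moreover, $$\Big(\int_{\mathbb R^N}\frac{\max\{\|\nabla u\|_{K^*}^2,\|-\nabla u\|_{K^*}^2\}}{\|x\|_K^{2b}}dx\Big)^{\frac12}\Big(\int_{\mathbb R^N}\frac{u^2}{\|x\|_K^{2a}}dx\Big)^{\frac12}\ \ge\ C_{ckn2}(N,a,b)\int_{\mathbb R^N}\frac{u^2}{\|x\|_K^{a+b+1}}dx,$$ where $C_{ckn2}(N,a,b)=\big|\frac{N-a-b-1}{2}\big|$ if $(a,b)\in\mathcal A$, $C_{ckn2}(N,a,b)=\big|\frac{N-3b+a-3}{2}\big|$ if $(a,b)\in\mathcal B$, and, when $a=b+1$, $C_{ckn2}(N,b+1,b)=\frac{|N-2(b+1)|}{2}$.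
   Context: $o$ is the origin of $\mathbb R^N$. A convex body is a compact convex subset of $\mathbb R^N$ with non-empty interior. $\mathcal K^{ss}_{(o)}$ is the set of convex bodies $K\subset\mathbb R^N$ that contain $o$ in their interior, are smooth (each boundary point has a unique outer unit normal vector) and strictly convex ($\partial K$ contains no line segment). $K$ is not assumed origin-symmetric. The Minkowski functional of a convex body $L$ containing $o$ in its interior is $\|x\|_L=\inf\{\lambda\ge0:x\in\lambda L\}$. The polar body is $K^*=\{x\in\mathbb R^N:x\cdot y\le1\text{ for all }y\in K\}$. Parameter regions in the $(a,b)$-plane: $\mathcal A=\mathcal A_1\cup\mathcal A_2$ and $\mathcal B=\mathcal B_1\cup\mathcal B_2$ with $\mathcal A_1=\{b>a-1,\ b\le\frac{N-2}2\}$, $\mathcal A_2=\{b<a-1,\ b\ge\frac{N-2}2\}$, $\mathcal B_1=\{b<a-1,\ b<\frac{N-2}2\}$, $\mathcal B_2=\{b>a-1,\ b>\frac{N-2}2\}$. *)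

(* Defs.v *)
From HB Require Import structures.
From mathcomp Require Import all_boot all_order all_algebra.
From mathcomp Require Import all_classical all_reals all_analysis.

Set Implicit Arguments.
Unset Strict Implicit.
Unset Printing Implicit Defensive.

Import Order.TTheory GRing.Theory Num.Theory.
Import numFieldNormedType.Exports.

Local Open Scope classical_set_scope.
Local Open Scope ring_scope.

(* The sigma-algebra on row vectors is generated by the coordinate functions,
   as the library does for [n.-tuple T]. *)
Fact rV_display : measure_display.
Proof. exact: default_measure_display. Qed.

Section measurable_rV.
Context {R : realType} {n : nat}.

Definition rV_coord (i : 'I_n) (x : 'rV[R]_n) : measurableTypeR R := x ord0 i.

Let rV_set0 : g_sigma_preimage rV_coord set0.
Proof. exact: sigma_algebra0. Qed.

Let rV_setC A : g_sigma_preimage rV_coord A -> g_sigma_preimage rV_coord (~` A).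
Proof. exact: sigma_algebraC. Qed.

Let rV_bigcup (F : (set 'rV[R]_n)^nat) :
  (forall i, g_sigma_preimage rV_coord (F i)) ->
  g_sigma_preimage rV_coord (\bigcup_i (F i)).
Proof. exact: sigma_algebra_bigcup. Qed.

HB.instance Definition _ := @isMeasurable.Build rV_display
  'rV[R]_n (g_sigma_preimage rV_coord) rV_set0 rV_setC rV_bigcup.

Lemma measurable_rV_coord (i : 'I_n) : measurable_fun setT (rV_coord i).
Proof.
move=> _ Y mY; rewrite setTI; apply: sub_sigma_algebra => /=.
rewrite -bigcup_seq/=; exists i => /=; first by rewrite mem_index_enum.
by exists Y => //; rewrite setTI.
Qed.

Lemma measurable_fun_rV d (T : measurableType d) (f : T -> 'rV[R]_n) :
  (forall i, measurable_fun setT (rV_coord i \o f)) -> measurable_fun setT f.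
Proof.
move=> mf _ Y mY; rewrite setTI.
suff : g_sigma_preimage rV_coord `<=` [set A | measurable (f @^-1` A)].
  exact.
apply: smallest_sub.
  split; rewrite /=.
  - by rewrite preimage_set0.
  - by move=> A mA; rewrite setTD preimage_setC; exact: measurableC.
  - by move=> F mF; rewrite preimage_bigcup; exact: bigcupT_measurable.
move=> A; rewrite -bigcup_seq => -[i _ [B mB <-]] /=.
rewrite setTI -comp_preimage -[X in measurable X]setTI.
exact: mf.
Qed.
End measurable_rV.

(* R^(n+1) as the product R * R^n. *)
Definition rV_cons (R : realType) (n : nat) (p : measurableTypeR R * 'rV[R]_n) :
    'rV[R]_n.+1 :=
  row_mx (p.1 : R)%:M p.2 : 'rV[R]_(1 + n).

Lemma rV_cons_lift (R : realType) (n : nat) (p : measurableTypeR R * 'rV[R]_n)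
  (i : 'I_n) : rV_cons p ord0 (lift ord0 i) = p.2 ord0 i.
Proof.
have -> : lift ord0 i = rshift 1 i by exact/val_inj.
exact: (@row_mxEr R 1 1 n).
Qed.

Lemma rV_cons0 (R : realType) (n : nat) (p : measurableTypeR R * 'rV[R]_n) :
  rV_cons p ord0 ord0 = p.1.
Proof.
have -> : ord0 = lshift n ord0 :> 'I_(1 + n) by exact/val_inj.
by rewrite /rV_cons (@row_mxEl R 1 1 n) mxE eqxx mulr1n.
Qed.

Lemma measurable_rV_cons (R : realType) (n : nat) :
  measurable_fun setT (@rV_cons R n).
Proof.
apply: measurable_fun_rV => i.
case: (unliftP ord0 i) => [j|] ->.
  rewrite (_ : _ \o _ = rV_coord j \o snd); last first.
    by apply/funext => p /=; rewrite /rV_coord rV_cons_lift.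
  by apply: measurableT_comp; [exact: measurable_rV_coord|exact: measurable_snd].
rewrite (_ : _ \o _ = fst); first exact: measurable_fst.
by apply/funext => p /=; rewrite /rV_coord rV_cons0.
Qed.

Section lebesgue_rV_step.
Context {R : realType} {n : nat}.
Variable mu : {sigma_finite_measure set 'rV[R]_n -> \bar R}.

Definition lebesgue_rV_step : set 'rV[R]_n.+1 -> \bar R :=
  pushforward (@lebesgue_measure R \x mu)%E (@rV_cons R n).

Let mcons A : measurable A -> measurable (@rV_cons R n @^-1` A).
Proof.
by move=> mA; rewrite -[X in measurable X]setTI; exact: measurable_rV_cons.
Qed.

Let step0 : lebesgue_rV_step set0 = 0%E.
Proof. by rewrite /lebesgue_rV_step /pushforward preimage_set0 measure0. Qed.

Let step_ge0 A : (0 <= lebesgue_rV_step A)%E.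
Proof. by rewrite /lebesgue_rV_step /pushforward; apply: measure_ge0. Qed.

Let step_sigma_additive : semi_sigma_additive lebesgue_rV_step.
Proof.
move=> F mF tF mUF; rewrite /lebesgue_rV_step /pushforward preimage_bigcup.
apply: measure_semi_sigma_additive.
- by move=> k; exact: mcons.
- apply/trivIsetP => /= i j _ _ ij; rewrite -preimage_setI.
  by move/trivIsetP : tF => /(_ _ _ _ _ ij) ->//; rewrite preimage_set0.
- by rewrite -preimage_bigcup; exact: mcons.
Qed.

HB.instance Definition _ := isMeasure.Build _ _ _
  lebesgue_rV_step step0 step_ge0 step_sigma_additive.

Let step_sigma_finite : sigma_finite setT lebesgue_rV_step.
Proof.
have /sigma_finiteP[F [TF ndF Foo]] : sigma_finite setT (@lebesgue_measure R).
  exact: sigma_finiteT.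
have /sigma_finiteP[G [TG ndG Goo]] := sigma_finiteT mu.
pose g (v : 'rV[R]_n.+1) : measurableTypeR R * 'rV[R]_n :=
  (v ord0 ord0, \row_i v ord0 (lift ord0 i)).
have mg : measurable_fun setT g.
  apply/measurable_fun_pairP; split; first exact: measurable_rV_coord.
  apply: measurable_fun_rV => i.
  rewrite (_ : _ \o _ = rV_coord (lift ord0 i)); first exact: measurable_rV_coord.
  by apply/funext => v /=; rewrite /rV_coord mxE.
have gK : cancel (@rV_cons R n) g.
  move=> [a v]; rewrite /g rV_cons0; congr pair.
  by apply/rowP => i; rewrite mxE rV_cons_lift.
exists (fun k => g @^-1` (F k `*` G k)).
  rewrite -preimage_bigcup (_ : \bigcup_k _ = setT) ?preimage_setT//.
  apply/seteqP; split => // -[x y] _.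
  have [p _ Fx] : (\bigcup_k F k) x by rewrite -TF.
  have [q _ Gy] : (\bigcup_k G k) y by rewrite -TG.
  exists (maxn p q) => //; split.
  - by move: x Fx; exact/subsetPset/ndF/leq_maxl.
  - by move: y Gy; exact/subsetPset/ndG/leq_maxr.
move=> k; have [mF Fk] := Foo k; have [mG Gk] := Goo k; split.
  by rewrite -[X in measurable X]setTI; apply: mg => //; exact: measurableX.
rewrite /lebesgue_rV_step /pushforward -comp_preimage (_ : g \o _ = id).
  by rewrite preimage_id product_measure1E// lte_mul_pinfty// ge0_fin_numE.
exact/funext.
Qed.

HB.instance Definition _ := Measure_isSigmaFinite.Build _ _ _
  lebesgue_rV_step step_sigma_finite.
End lebesgue_rV_step.

Fixpoint lebesgue_rV (R : realType) (n : nat) :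
    {sigma_finite_measure set 'rV[R]_n -> \bar R} :=
  match n with
  | 0 => dirac (0 : 'rV[R]_0)
  | n'.+1 => lebesgue_rV_step (lebesgue_rV R n')
  end.

Lemma lebesgue_rV_box (R : realType) (n : nat)
    (A : 'I_n -> set (measurableTypeR R)) :
  (forall i, measurable (A i)) ->
  lebesgue_rV R n [set x | forall i, A i (x ord0 i)] =
  (\prod_(i < n) lebesgue_measure (A i))%E.
Proof.
elim: n A => [|n IHn] A mA.
  rewrite big_ord0 /= diracE mem_set//.
  by case.
rewrite big_ord_recl -IHn//= /lebesgue_rV_step /pushforward.
rewrite -product_measure1E//.
- congr (product_measure1 _ _ _); apply/seteqP; split => -[a v] /=.
    move=> Av; split; first by move: (Av ord0); rewrite rV_cons0.
    by move=> i; move: (Av (lift ord0 i)); rewrite rV_cons_lift.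
  move=> [Aa Av] i; case: (unliftP ord0 i) => [j|] ->.
    by rewrite rV_cons_lift; exact: Av.
  by rewrite rV_cons0.
- rewrite [X in measurable X](_ : _ = \bigcap_(i in [set: 'I_n])
      (rV_coord i @^-1` A (lift ord0 i))); last first.
    by apply/seteqP; split => [v + i _|v + i]; exact.
  apply: fin_bigcap_measurable => // i _.
  by rewrite -[X in measurable X]setTI; exact: measurable_rV_coord.
Qed.

Section convex_bodies.
Context {R : realType} {N : nat}.
Implicit Types (x y : 'rV[R]_N) (K L : set 'rV[R]_N).

Definition dot x y : R := \sum_(i < N) x ord0 i * y ord0 i.

Definition frontier K : set 'rV[R]_N := closure K `\` interior K.

Definition convex_body K : Prop :=
  [/\ compact K, @convex_set R 'rV[R]_N K & interior K !=set0].

Definition outer_unit_normal K x n : Prop :=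
  dot n n = 1 /\ forall y, K y -> dot n y <= dot n x.

Definition smooth_body K : Prop :=
  forall x, frontier K x -> exists! n, outer_unit_normal K x n.

Definition line_segment x y : set 'rV[R]_N :=
  [set (1 - t) *: x + t *: y | t in `[0, 1]].

Definition strictly_convex K : Prop :=
  forall x y, x != y -> ~ (line_segment x y `<=` frontier K).

(* The class K^ss_(o). *)
Definition Kss_o K : Prop :=
  [/\ convex_body K, interior K 0, smooth_body K & strictly_convex K].

Definition mink L x : R :=
  inf [set l | 0 <= l /\ exists2 y, L y & x = l *: y].

Definition polar K : set 'rV[R]_N := [set x | forall y, K y -> dot x y <= 1].

End convex_bodies.

Section test_functions.
Context {R : realType} {N : nat}.
Implicit Types u : 'rV[R]_N -> R.

Definition partial (i : 'I_N) u : 'rV[R]_N -> R :=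
  'D_(delta_mx ord0 i : 'rV[R]_N) u.

Definition iter_partial (s : seq 'I_N) u : 'rV[R]_N -> R := foldr partial u s.

Definition Cinfty u : Prop :=
  forall s : seq 'I_N, continuous (iter_partial s u) /\
    forall (i : 'I_N) (x : 'rV[R]_N),
      derivable (iter_partial s u) x (delta_mx ord0 i).

Definition tsupport u : set 'rV[R]_N := closure [set x | u x != 0].

(* C_c^infty(R^N \ {o}), with functions extended by 0 at the origin. *)
Definition Ccinfty_off0 u : Prop :=
  [/\ Cinfty u, compact (tsupport u) & ~ tsupport u 0].

Definition grad u (x : 'rV[R]_N) : 'rV[R]_N := \row_(i < N) partial i u x.

End test_functions.

Section ckn.
Context {R : realType} (N : nat).
Implicit Types (a b : R) (K : set 'rV[R]_N) (u : 'rV[R]_N -> R).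

Definition regionA a b : bool :=
  (a - 1 < b) && (b <= (N%:R - 2) / 2) || (b < a - 1) && ((N%:R - 2) / 2 <= b).

Definition regionB a b : bool :=
  (b < a - 1) && (b < (N%:R - 2) / 2) || (a - 1 < b) && ((N%:R - 2) / 2 < b).

(* The two regions and the line [a = b + 1] partition the plane: the last
   branch of each constant is the case [a = b + 1]. *)
Lemma regionAB a b : a != b + 1 -> regionA a b (+) regionB a b.
Proof.
rewrite /regionA /regionB -subr_eq.
by case: (ltgtP b (a - 1)) => //= _ _; case: (ltgtP b ((N%:R - 2) / 2)).
Qed.

Lemma regionAB_diag b : ~~ regionA (b + 1) b && ~~ regionB (b + 1) b.
Proof. by rewrite /regionA /regionB addrK ltxx. Qed.

Definition C_ckn1 a b : R :=
  if regionA a b then `|N%:R - a - b - 1|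
  else if regionB a b then `|N%:R - 3 * b + a - 3|
  else 1 + (N%:R - 2 * b - 2) ^+ 2 / 4.

Definition C_ckn2 a b : R :=
  if regionA a b then `|(N%:R - a - b - 1) / 2|
  else if regionB a b then `|(N%:R - 3 * b + a - 3) / 2|
  else `|N%:R - 2 * (b + 1)| / 2.

Definition gradient_term K u b : \bar R :=
  (\int[lebesgue_rV R N]_x
     (Num.max (mink (polar K) (grad u x) ^+ 2)
              (mink (polar K) (- grad u x) ^+ 2)
      / mink K x `^ (2 * b))%:E)%E.

Definition weighted_square K u c : \bar R :=
  (\int[lebesgue_rV R N]_x (u x ^+ 2 / mink K x `^ c)%:E)%E.

End ckn.

(* Main.v *)
From HB Require Import structures.
Require Import Defs.
From mathcomp Require Import all_boot all_order all_algebra.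
From mathcomp Require Import all_classical all_reals all_analysis.
From mathcomp Require Import measurable_realfun.
From mathcomp Require Import ring lra.

Set Implicit Arguments.
Unset Strict Implicit.
Unset Printing Implicit Defensive.

Import Order.TTheory GRing.Theory Num.Theory.
Import numFieldNormedType.Exports.

Local Open Scope classical_set_scope.
Local Open Scope ring_scope.

(** Only the derivative of [u] along rays matters. Write [r] for the gauge of
    [K], [h] for the gauge of its polar, and [E u = x . grad u] for the Euler
    operator. Since [x / r x] lies in [K] up to an arbitrarily small factor, the
    polar gauge satisfies [w . x <= h w * r x] ([dot_le_mink_polar]), so the
    gradient term is at least the integral of [(E u)^2 r^(-2b-2)]
    ([gradient_term_ge]), and both inequalities follow from one-dimensional ones
    along rays.

    Those rest on a single identity ([radial_identity]): for every exponent [c],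
    [2 \int u (E u) r^(-c) = (c - N) \int u^2 r^(-c)]. It is the divergence
    theorem for the field [u^2 r^(-c) x], but it is obtained by scaling, which
    spares any differentiation of [r]: as [r] is 1-homogeneous, the change of
    variables [x -> t x] turns [\int u(t x)^2 r(x)^(-c) dx] into
    [t^(c-N) \int u^2 r^(-c)] ([gauge_integral_dilation]), and both sides are
    differentiated at [t = 1], the left one under the integral sign.

    For real [k] and [l], expanding the integral of the square
    [((E u - k u) r^(-b-1) + l u r^(-a))^2] and removing the cross terms
    [u (E u)] by the identity gives
    [0 <= X - k (2b+2-N-k) W + l (a+b+1-N-2k) Z + l^2 Y],
    where [X] is the radial gradient integral, and [W], [Z], [Y] are the
    integrals of [u^2] against [r] to the powers [-(2b+2)], [-(a+b+1)], [-2a]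
    ([radial_quadratic_form_ge0]). The term in [W] disappears for [k = 0] and
    for [k = 2b+2-N]; the first choice produces the constant of the region A,
    the second one, which amounts to the substitution [u = r^(2b+2-N) v], that
    of the region B. In both cases [l = 1] and [l = -1] give the additive
    inequality and the discriminant in [l] gives the multiplicative one
    ([ckn_of_annihilating_shift]). On the line [a = b+1], where [W], [Z] and [Y]
    coincide, the additive constant comes from [l = 0] and the [k] that
    maximizes [k (2b+2-N-k)] ([hardy]). *)

(** * Borel measurability on row vectors *)

Lemma mx_norm_entry_le (R : realType) (n : nat) (x : 'rV[R]_n) (i : 'I_n) :
  `|x ord0 i| <= `|x|.
Proof.
rewrite [leRHS]/Num.Def.normr/= mx_normrE.
exact: (le_bigmax _ (fun ij => `|x ij.1 ij.2|) (ord0, i)).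
Qed.

Lemma mx_norm_leP (R : realType) (n : nat) (x : 'rV[R]_n) (e : R) :
  0 <= e -> (forall i, `|x ord0 i| <= e) -> `|x| <= e.
Proof.
move=> e0 xe; rewrite [leLHS]/Num.Def.normr/= mx_normrE (bigmax_le _ e0)//.
by move=> [j i] _; rewrite /= (ord1 j).
Qed.

(** The sigma-algebra generated by the coordinates contains the open sets since
    each of these is a countable union of closed cubes with rational centres. *)
Lemma open_measurable_rV (R : realType) (n : nat) (U : set 'rV[R]_n) :
  open U -> measurable U.
Proof.
move=> oU.
pose box (q : 'rV[rat]_n * nat) : set 'rV[R]_n :=
  [set x | forall i, `|x ord0 i - ratr (q.1 ord0 i)| <= q.2.+1%:R^-1].
have mbox q : measurable (box q).
  rewrite [X in measurable X](_ : _ = \bigcap_(i in [set: 'I_n])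
      (rV_coord i @^-1` `[ratr (q.1 ord0 i) - q.2.+1%:R^-1,
                          ratr (q.1 ord0 i) + q.2.+1%:R^-1]%classic)).
    apply: fin_bigcap_measurable => // i _.
    rewrite -[X in measurable X]setTI; apply: measurable_rV_coord => //.
  apply/seteqP; split => [v + i _|v + i] => /(_ i).
    by rewrite /= in_itv/= ler_distl.
  by move=> /(_ I); rewrite /= in_itv/= ler_distl.
have -> : U = \bigcup_(q in [set q | box q `<=` U]) box q.
  apply/seteqP; split => [x Ux|x [q qU]]; last exact: qU.
  have /nbhs_ballP[e /= e0 xeU] : nbhs x U by exact: open_nbhs_nbhs.
  (* two points of a cube with half-side 1 / (k + 1) are less than e apart *)
  pose k := Num.trunc (2 / e).
  have ke : k.+1%:R^-1 < e / 2.
    rewrite -[ltRHS]invrK ltf_pV2 ?posrE ?invr_gt0 ?divr_gt0//.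
    by rewrite invf_div truncnS_gt.
  have k0 : 0 < k.+1%:R^-1 :> R by rewrite invr_gt0.
  have /choice[q xq] : forall i : 'I_n, exists q : rat,
      `|x ord0 i - ratr q| <= k.+1%:R^-1.
    move=> i; have [q] := @rat_in_itvoo R (x ord0 i) (x ord0 i + k.+1%:R^-1)
      ltac:(by rewrite ltrDl).
    rewrite in_itv/= => /andP[h1 h2]; exists q.
    by rewrite ler_distlC (ltW h2) andbT (le_trans _ (ltW h1))// gerBl ltW.
  exists (\row_i q i, k) => /=; last by move=> i; rewrite mxE; exact: xq.
  move=> y /= yq; apply: xeU; rewrite -ball_normE /ball_/=.
  apply: (@le_lt_trans _ _ (k.+1%:R^-1 + k.+1%:R^-1)); last first.
    by rewrite [ltRHS]splitr ltrD.
  apply: mx_norm_leP => [|i]; first by rewrite addr_ge0 // ltW.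
  rewrite !mxE -(subrKA (ratr (q i))) (le_trans (ler_normD _ _))// lerD//.
  by move: (yq i); rewrite mxE distrC.
rewrite bigcup_mkcond; apply: countable_bigcupT_measurable => // q.
by case: ifPn.
Qed.

Lemma continuous_measurable_rV (R : realType) (n : nat) (f : 'rV[R]_n -> R) :
  continuous f -> measurable_fun setT f.
Proof.
move=> cf; apply: (measurability _ (RGenOpens.measurableE R)).
move=> _ [_ [a [b ->] <-]]; rewrite setTI; apply: open_measurable_rV.
by apply: open_comp => [x _|]; [exact: cf|exact: interval_open].
Qed.

Lemma measurable_rV_dilation (R : realType) (n : nat) (t : R) :
  measurable_fun setT (fun x : 'rV[R]_n => t *: x).
Proof.
apply: measurable_fun_rV => i.
rewrite (_ : _ \o _ = (fun r : measurableTypeR R => t * r) \o rV_coord i).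
  apply: measurableT_comp; last exact: measurable_rV_coord.
  exact: mulrl_measurable.
by apply/funext => x; rewrite /rV_coord /= mxE.
Qed.

(** * Dilations and Lebesgue measure *)

Definition homothety {R : realType} (t : R) (x : measurableTypeR R) :
  measurableTypeR R := t * x.

Lemma measurable_homothety (R : realType) (t : R) :
  measurable_fun setT (homothety t).
Proof. exact: mulrl_measurable. Qed.

Definition homothetic_lebesgue {R : realType} (t : R) :
  set (measurableTypeR R) -> \bar R :=
  pushforward lebesgue_measure (homothety t).

HB.instance Definition _ (R : realType) (t : R) :=
  Measure.copy (homothetic_lebesgue t)
    (measure_function_pushforward__canonical__measure_function_Measure
      lebesgue_measure (measurable_homothety t)).

(** Uniqueness of Lebesgue measure leaves only half-open intervals to check. *)
Lemma lebesgue_measure_homothety (R : realType) (t : {posnum R})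
    (A : set (measurableTypeR R)) : measurable A ->
  mscale t%:num%:nng (homothetic_lebesgue t%:num) A =
  lebesgue_measure A.
Proof.
move=> mA; symmetry; apply: lebesgue_measure_unique mA.
move=> _ [[a b] _ <-] /=; rewrite /mscale/=.
have -> : homothetic_lebesgue t%:num `]a, b] =
    lebesgue_measure `]t%:num^-1 * a, t%:num^-1 * b].
  congr (lebesgue_measure _); apply/seteqP.
  split => x; rewrite /homothety /= !in_itv/=;
    by rewrite (mulrC _ a) (mulrC _ b) ltr_pdivrMr// ler_pdivlMr// (mulrC x).
rewrite !lebesgue_measure_itv/= !lte_fin ltr_pM2l ?invr_gt0//.
case: ifPn => _; last by rewrite mule0.
by rewrite -!EFinB -EFinM -mulrBr mulrA divff ?mul1r.
Qed.

Lemma integral_homothety (R : realType) (t : {posnum R})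
    (g : measurableTypeR R -> \bar R) :
  measurable_fun setT g -> (forall x, (0 <= g x)%E) ->
  (t%:num%:E * \int[lebesgue_measure]_x g (homothety t%:num x) =
   \int[lebesgue_measure]_x g x)%E.
Proof.
move=> mg g0; transitivity
    (\int[mscale (t%:num%:nng)%R (homothetic_lebesgue t%:num)]_x g x)%E.
  rewrite ge0_integral_mscale//= /homothetic_lebesgue.
  by rewrite ge0_integral_pushforward//; exact: measurable_homothety.
by apply: eq_measure_integral => A mA _; exact: lebesgue_measure_homothety.
Qed.

(** Dilations act coordinatewise, so Tonelli's theorem reduces the change of
    variables to the one-dimensional one. *)
Lemma integral_rV_dilation (R : realType) (n : nat) (t : {posnum R})
    (g : 'rV[R]_n -> \bar R) :
  measurable_fun setT g -> (forall x, (0 <= g x)%E) ->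
  ((t%:num ^+ n)%:E * \int[lebesgue_rV R n]_x g (t%:num *: x) =
   \int[lebesgue_rV R n]_x g x)%E.
Proof.
elim: n g => [|n IHn] g mg g0.
  rewrite expr0 mul1e; apply: eq_integral => x _; congr g.
  by apply/rowP; case.
have pushE (h : 'rV[R]_n.+1 -> \bar R) : measurable_fun setT h ->
    (forall x, 0 <= h x)%E -> (\int[lebesgue_rV R n.+1]_x h x =
    \int[lebesgue_measure]_x \int[lebesgue_rV R n]_y h (rV_cons (x, y)))%E.
  move=> mh h0; rewrite [LHS]ge0_integral_pushforward//; last first.
    exact: measurable_rV_cons.
  rewrite preimage_setT (@fubini_tonelli1 _ _ _ _ R _ (lebesgue_rV R n)
    (h \o @rV_cons R n))//; last by move=> x; exact: h0.
  by apply: measurableT_comp => //; exact: measurable_rV_cons.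
rewrite !pushE//; last first.
  by apply: measurableT_comp => //; exact: measurable_rV_dilation.
have gE x : (\int[lebesgue_rV R n]_y g (rV_cons (homothety t%:num x, y)) =
    (t%:num ^+ n)%:E *
      \int[lebesgue_rV R n]_y g (t%:num *: rV_cons (x, y)))%E.
  rewrite -IHn//; last first.
    apply: measurableT_comp => //; apply: measurableT_comp.
      exact: measurable_rV_cons.
    exact: pair1_measurable.
  congr (_ * _)%E; apply: eq_integral => y _; congr g; apply/rowP => i.
  case: (unliftP ord0 i) => [j|] ->.
    by rewrite rV_cons_lift [LHS]mxE [RHS]mxE rV_cons_lift.
  by rewrite rV_cons0 [RHS]mxE rV_cons0.
have mF (h : 'rV[R]_n.+1 -> \bar R) : measurable_fun setT h ->
    (forall x, 0 <= h x)%E -> measurable_fun setT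
    (fun x : measurableTypeR R => \int[lebesgue_rV R n]_y h (rV_cons (x, y)))%E.
  move=> mh h0; apply: (@measurable_fun_fubini_tonelli_F _ _ _ _ R
    (lebesgue_rV R n) (h \o @rV_cons R n)); last by move=> x; exact: h0.
  by apply: measurableT_comp => //; exact: measurable_rV_cons.
rewrite -(@integral_homothety _ t
    (fun x => \int[lebesgue_rV R n]_y g (rV_cons (x, y)))%E)//; last 2 first.
- exact: mF.
- by move=> x; exact: integral_ge0.
under [in RHS]eq_integral do rewrite gE.
rewrite ge0_integralZl_EFin//=.
- by rewrite muleA -EFinM -exprS.
- by move=> x _; exact: integral_ge0.
- apply: (mF (fun z => g (t%:num *: z))) => //.
  by apply: measurableT_comp => //; exact: measurable_rV_dilation.
Qed.

(** * Directional derivatives from partial derivatives *)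

Lemma is_derive_line (R : realType) (V : normedModType R) (u : V -> R)
    (z e : V) (t : R) :
  derivable u (t *: e + z) e ->
  is_derive t 1 (fun s : R => u (s *: e + z)) ('D_e u (t *: e + z)).
Proof.
move=> du; have E : (fun h : R =>
      h^-1 *: (u ((h *: 1 + t) *: e + z) - u (t *: e + z))) =
    (fun h : R => h^-1 *: (u (h *: e + (t *: e + z)) - u (t *: e + z))).
  by apply/funext => h; rewrite [h *: 1]mulr1 scalerDl addrA.
split; first by rewrite /derivable/= E.
by rewrite /derive/= E.
Qed.

(** The absolute values make this form of the mean value theorem insensitive to
    the sign of [a], which varies in difference quotients. *)
Lemma mean_value_from0 (R : realType) (f df : R -> R) (a : R) :
  (forall t : R, is_derive t 1 f (df t)) ->
  exists2 t, `|t| <= `|a| & f a - f 0 = a * df t.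
Proof.
move=> fdf.
have cf b c : {within `[b, c], continuous f}.
  apply: continuous_subspaceT => x.
  by apply: differentiable_continuous; apply/derivable1_diffP; case: (fdf x).
have [a0|a0|->] := ltgtP a 0.
- have [c + E] := MVT a0 (fun x _ => fdf x) (cf a 0).
  rewrite in_itv/= => /andP[ac c0]; exists c.
    by rewrite !ler0_norm ?ltW// ltrN2.
  by apply: oppr_inj; rewrite opprB E; ring.
- have [c + E] := MVT a0 (fun x _ => fdf x) (cf 0 a).
  rewrite in_itv/= => /andP[ac c0]; exists c.
    by rewrite !ger0_norm ?ltW.
  by rewrite E; ring.
- by exists 0; rewrite // subrr mul0r.
Qed.

(** The base point [h w + y] moves with [h]: by the mean value theorem the
    increment along the [i]-th axis is a value of the partial derivative at a
    point tending to [y], and that derivative is continuous at [y]. *)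
Lemma cvg_partial_increment (R : realType) (n : nat) (u : 'rV[R]_n -> R)
    (i : 'I_n) (y w : 'rV[R]_n) (c : R) :
  (forall x, derivable u x (delta_mx ord0 i)) -> continuous (partial i u) ->
  h^-1 *: (u (h *: (w + c *: delta_mx ord0 i) + y) - u (h *: w + y))
    @[h --> 0^'] --> c * partial i u y.
Proof.
move=> du cdu; set e : 'rV[R]_n := delta_mx ord0 i.
apply/cvgrPdist_lt => eps eps0.
pose M := `|c| + 1; have M0 : 0 < M by rewrite ltr_wpDl.
have /(@cvgrPdist_lt _ R)/(_ (eps / M)) := cdu y.
rewrite divr_gt0// => /(_ isT) /nbhs_ballP[d /= d0 yd].
pose L := `|w| + `|c *: e| + 1.
have L0 : 0 < L by rewrite ltr_wpDl// addr_ge0.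
near=> h.
have hL : `|h| * L < d.
  rewrite -ltr_pdivlMr//; near: h; apply: dnbhs0_lt; exact: divr_gt0.
have h0 : h != 0 by near: h; exact: nbhs_dnbhs_neq.
have [t th E] := mean_value_from0 (h * c)
  (fun t => @is_derive_line _ _ u (h *: w + y) e t (du _)).
have -> : u (h *: (w + c *: e) + y) - u (h *: w + y) =
    h * c * partial i u (t *: e + (h *: w + y)).
  rewrite -E scale0r add0r; congr (u _ - _).
  by rewrite scalerDr scalerA addrCA addrA.
rewrite [_ *: _]mulrA mulKf// -mulrBr normrM.
apply: (@le_lt_trans _ _ (`|c| * (eps / M))).
  rewrite ler_wpM2l// ltW//; apply: yd; rewrite -ball_normE /ball_/=.
  rewrite distrC addrA addrK; apply: le_lt_trans hL.
  rewrite (le_trans (ler_normD _ _))// !mulrDr mulr1 -addrA addrC lerD//.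
    rewrite -[leLHS]addr0 lerD// normrZ normrZ mulrA -normrM.
    by rewrite ler_wpM2r.
  by rewrite normrZ.
rewrite mulrCA gtr_pMr// ltr_pdivrMr// mul1r /M ltrDl//.
Unshelve. all: by end_near. Qed.

(** Continuous partial derivatives determine all directional derivatives: the
    increment of [u] in the direction [v] is split axis by axis. *)
Lemma is_derive_dot_grad (R : realType) (n : nat) (u : 'rV[R]_n -> R)
    (y v : 'rV[R]_n) :
  (forall i x, derivable u x (delta_mx ord0 i)) ->
  (forall i, continuous (partial i u)) ->
  is_derive y v u (dot (grad u y) v).
Proof.
move=> du cdu.
suff H : h^-1 *: (u (h *: v + y) - u y) @[h --> 0^'] --> dot (grad u y) v.
  by split; [apply/cvg_ex; eexists; exact: H|exact: cvg_lim H].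
pose part (s : seq 'I_n) : 'rV[R]_n :=
  \sum_(j <- s) v ord0 j *: delta_mx ord0 j.
suff H s : h^-1 *: (u (h *: part s + y) - u y) @[h --> 0^'] -->
    \sum_(j <- s) v ord0 j * partial j u y.
  have := H (index_enum _); rewrite /part -row_sum_delta /dot.
  under eq_bigr do rewrite mulrC.
  by under [in X in _ -> X]eq_bigr do rewrite mxE.
elim: s => [|i s IHs].
  rewrite big_nil (_ : (fun _ => _) = cst 0); first exact: cvg_cst.
  by apply/funext => h; rewrite /part big_nil scaler0 add0r subrr scaler0.
rewrite big_cons (_ : (fun _ => _) = fun h : R =>
    h^-1 *: (u (h *: (part s + v ord0 i *: delta_mx ord0 i) + y)
             - u (h *: part s + y)) +
    h^-1 *: (u (h *: part s + y) - u y)).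
  by apply: cvgD IHs; exact: cvg_partial_increment.
by apply/funext => h; rewrite -scalerDr subrKA [part s + _]addrC /part big_cons.
Qed.

(** * The gauge of a convex neighbourhood of the origin *)

Section gauge.
Context {R : realType} {n : nat}.
Implicit Types (x y w : 'rV[R]_n) (K L : set 'rV[R]_n).

Lemma mink_le L x y l : 0 <= l -> L y -> x = l *: y -> mink L x <= l.
Proof.
by move=> l0 Ly xy; apply: ge_inf; [exists 0 => ? -[]|split => //; exists y].
Qed.

Lemma mink_ge L x c : (exists l y, [/\ 0 <= l, L y & x = l *: y]) ->
  (forall l y, 0 <= l -> L y -> x = l *: y -> c <= l) -> c <= mink L x.
Proof.
move=> [l [y [l0 Ly xy]]] cl.
apply: lb_le_inf; first by exists l; split => //; exists y.
by move=> k [k0 [z Lz xz]]; exact: cl xz.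
Qed.

Lemma mink_ge0 L x : 0 <= mink L x.
Proof.
have [S0|/set0P[l Sl]] :=
    eqVneq [set l | 0 <= l /\ exists2 y, L y & x = l *: y] set0.
  by rewrite /mink S0 inf0.
by apply: lb_le_inf; [exists l|move=> ? []].
Qed.

Context {K : set 'rV[R]_n}.
Hypothesis K0 : nbhs (0 : 'rV[R]_n) K.

(** [K] contains a ball around the origin, so it absorbs every point at a scale
    proportional to its norm. *)
Lemma gauge_decomposition : exists2 m, 0 < m &
  forall x, exists2 y, K y & x = (m * `|x|) *: y.
Proof.
have /nbhs_ballP[e /= e0 eK] := K0.
exists (2 / e) => [|x]; first exact: divr_gt0.
have [->|x0] := eqVneq x 0.
  by exists 0; [exact: nbhs_singleton|rewrite scaler0].
have m0 : 2 / e * `|x| != 0 by rewrite mulf_neq0 ?normr_eq0// gt_eqF ?divr_gt0.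
exists ((2 / e * `|x|)^-1 *: x); last by rewrite scalerA divff// scale1r.
apply: eK; rewrite -ball_normE /ball_/= sub0r normrN normrZ normfV.
rewrite normrM normr_id gtr0_norm ?divr_gt0// invfM mulfVK ?normr_eq0//.
by rewrite invf_div gtr_pMr// invf_lt1// ltr1n.
Qed.

Lemma gauge_nonempty x : exists l y, [/\ 0 <= l, K y & x = l *: y].
Proof.
have [m m0 /(_ x)[y Ky xy]] := gauge_decomposition.
by exists (m * `|x|), y; split => //; rewrite mulr_ge0// ltW.
Qed.

Lemma mink_le_norm : exists2 m, 0 < m & forall x, mink K x <= m * `|x|.
Proof.
have [m m0 mP] := gauge_decomposition; exists m => // x.
by have [y Ky xy] := mP x; apply: mink_le Ky xy; rewrite mulr_ge0// ltW.
Qed.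

Lemma minkZ (t : R) x : 0 < t -> mink K (t *: x) = t * mink K x.
Proof.
have le (s : R) z : 0 < s -> mink K (s *: z) <= s * mink K z.
  move=> s0; rewrite mulrC -ler_pdivrMr//; apply: mink_ge.
    exact: gauge_nonempty.
  move=> l y l0 Ky ->; rewrite ler_pdivrMr//.
  by apply: (mink_le _ Ky); rewrite ?mulr_ge0 ?(ltW s0)// scalerA mulrC.
move=> t0; apply/eqP; rewrite eq_le le//=.
rewrite -ler_pdivlMl//; apply: le_trans (le _ _ _).
  by rewrite scalerA mulVf ?scale1r// gt_eqF.
by rewrite invr_gt0.
Qed.

Lemma mink_norm_ge : bounded_set K ->
  exists2 M, 0 < M & forall x, `|x| <= M * mink K x.
Proof.
move=> /ex_strict_bound_gt0[M M0 KM]; exists M => // x.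
rewrite -ler_pdivrMl//; apply: mink_ge; first exact: gauge_nonempty.
move=> l y l0 /KM/ltW yM ->.
by rewrite ler_pdivrMl// normrZ ger0_norm// mulrC ler_wpM2r.
Qed.

(** If [w = l y] and [x = k z] with [y] in the polar and [z] in [K], then
    [w . x = l k (y . z) <= l k]; the infima over [k] and [l] give the claim.
    Boundedness of [K] makes the polar absorbing, without which the infimum over
    [l] could be the default value of an empty one. *)
Lemma dot_le_mink_polar : bounded_set K ->
  forall w x, dot w x <= mink (polar K) w * mink K x.
Proof.
move=> bK w x.
have Kx := gauge_nonempty x.
have dotZ (a b : R) (y z : 'rV[R]_n) : dot (a *: y) (b *: z) = a * b * dot y z.
  by rewrite /dot mulr_sumr; apply: eq_bigr => i _; rewrite !mxE; ring.
have Pw : exists l y, [/\ 0 <= l, polar K y & w = l *: y].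
  have /ex_strict_bound_gt0[M M0 KM] := bK.
  pose c := n%:R * (`|w| * M) + 1.
  have c0 : 0 < c by rewrite ltr_wpDl// !mulr_ge0// ltW.
  exists c, (c^-1 *: w); split; first exact: ltW.
    move=> y /KM/ltW yM; rewrite -(scale1r y) dotZ mulr1.
    rewrite ler_pdivrMl// mulr1.
    apply: (@le_trans _ _ (n%:R * (`|w| * M))); last by rewrite lerDl.
    have -> : n%:R * (`|w| * M) = \sum_(i < n) `|w| * M.
      by rewrite sumr_const card_ord mulr_natl.
    apply: ler_sum => i _.
    rewrite (le_trans (ler_norm _))// normrM ler_pM ?mx_norm_entry_le//.
    exact: le_trans (mx_norm_entry_le _ _) yM.
  by rewrite scalerA divff ?scale1r// gt_eqF.
have step l y : 0 <= l -> polar K y -> w = l *: y -> dot w x <= l * mink K x.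
  rewrite le_eqVlt => /predU1P[<- _ ->|l0 Py ->].
    by rewrite mul0r -(scale1r x) dotZ !mul0r.
  rewrite -ler_pdivrMl//; apply: mink_ge => // k z k0 Kz ->.
  by rewrite dotZ ler_pdivrMl// -[leRHS]mulr1 ler_wpM2l// ?mulr_ge0 ?Py// ltW.
have [r0|r0] := eqVneq (mink K x) 0.
  have [l [y [l0 Py wy]]] := Pw.
  by have := step _ _ l0 Py wy; rewrite r0 !mulr0.
have {}r0 : 0 < mink K x by rewrite lt_neqAle eq_sym r0 mink_ge0.
rewrite -ler_pdivrMr//; apply: mink_ge => // l y l0 Py wy.
by rewrite ler_pdivrMr//; exact: step wy.
Qed.

Hypothesis cK : @convex_set R 'rV[R]_n K.

Lemma mink_subadditive x y : mink K (x + y) <= mink K x + mink K y.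
Proof.
suff step l z k v : 0 <= l -> K z -> 0 <= k -> K v -> x = l *: z ->
    y = k *: v -> mink K (x + y) <= l + k.
  rewrite -lerBlDr; apply: mink_ge; first exact: gauge_nonempty.
  move=> l z l0 Kz xz; rewrite lerBlDr -lerBlDl.
  apply: mink_ge; first exact: gauge_nonempty.
  by move=> k v k0 Kv yv; rewrite lerBlDl; exact: (step l z k v).
move=> l0 Kz k0 Kv -> ->.
have [lk0|lk0] := eqVneq (l + k) 0.
  move: lk0 => /eqP; rewrite paddr_eq0// => /andP[/eqP-> /eqP->].
  by rewrite !scale0r; apply: mink_le Kz _; rewrite ?addr0 ?scale0r.
have {}lk0 : 0 < l + k by rewrite lt_neqAle eq_sym lk0 addr_ge0.
(* l z + k v is l + k times a convex combination of z and v *)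
have p0 : 0 <= l / (l + k) by rewrite divr_ge0// ltW.
have p1 : l / (l + k) <= 1 by rewrite ler_pdivrMr// mul1r lerDl.
have Kzv : K ((l / (l + k)) *: z + (1 - l / (l + k)) *: v).
  exact: set_mem (cK (Itv01 p0 p1) (mem_set Kz) (mem_set Kv)).
apply: mink_le Kzv _; first exact: ltW.
rewrite scalerDr !scalerA (_ : 1 - _ = k / (l + k)); last first.
  by rewrite -[1](@divff _ (l + k)) ?gt_eqF// -mulrBl addrAC subrr add0r.
by rewrite mulrC divfK ?gt_eqF// mulrC divfK ?gt_eqF.
Qed.

(** A sublinear function dominated by a multiple of the norm is Lipschitz. *)
Lemma continuous_mink : continuous (mink K).
Proof.
have [m m0 Km] := mink_le_norm.
have lip x y : `|mink K x - mink K y| <= m * `|x - y|.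
  have half a b : mink K a - mink K b <= m * `|a - b|.
    rewrite lerBlDl (le_trans _ (lerD (lexx _) (Km _)))//.
    by rewrite (le_trans _ (mink_subadditive _ _))// addrC subrK.
  by rewrite ler_norml lerNl opprB half distrC half.
move=> x A /nbhs_ballP[e /= e0 eA]; apply/nbhs_ballP.
exists (m^-1 * e) => [|y]; first by rewrite /= mulr_gt0 ?invr_gt0.
rewrite -ball_normE /ball_/= => xy; apply: eA; rewrite -ball_normE /ball_/=.
by apply: le_lt_trans (lip _ _) _; rewrite -ltr_pdivlMl.
Qed.

End gauge.

(** * Integrability against powers of the gauge *)

Section annular.
Context {R : realType} {n : nat}.
Implicit Types (f g : 'rV[R]_n -> R).

(** Every power of the gauge is bounded on an annulus, so the functions of this
    class are integrable against all of them; the class is closed under products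
    and dilations. *)
Definition annular f : Prop := measurable_fun setT f /\
  exists d r M : R, [/\ 0 < d, forall x, `|f x| <= M &
    forall x, f x != 0 -> d <= `|x| <= r].

Lemma annularM f g : annular f -> annular g -> annular (fun x => f x * g x).
Proof.
move=> [mf [d [r [M [d0 fM fdr]]]]] [mg [_ [_ [L [_ gL _]]]]].
split; first exact: measurable_funM.
exists d, r, (M * L); split => // x; first by rewrite normrM ler_pM.
by rewrite mulf_eq0 => /norP[/fdr].
Qed.

Definition annulus (d r : R) : set 'rV[R]_n := [set x | d <= `|x| <= r].

Lemma measurable_annulus d r : measurable (annulus d r).
Proof.
have -> : annulus d r = (@Num.norm _ 'rV[R]_n) @^-1` `[d, r].
  by apply/seteqP; split => x; rewrite /annulus/= in_itv.
rewrite -[X in measurable X]setTI.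
apply: continuous_measurable_rV => //; exact: norm_continuous.
Qed.

Lemma lebesgue_annulus_lty d r : (lebesgue_rV R n (annulus d r) < +oo)%E.
Proof.
pose box := [set x : 'rV[R]_n | forall i, `[- r, r]%classic (x ord0 i)].
have mbox : measurable box.
  rewrite [X in measurable X](_ : _ = \bigcap_(i in [set: 'I_n])
      (rV_coord i @^-1` `[- r, r]%classic)).
    apply: fin_bigcap_measurable => // i _.
    by rewrite -[X in measurable X]setTI; apply: measurable_rV_coord.
  by apply/seteqP; split => [v + i _|v + i]; [exact|move=> /(_ i I)].
apply: (@le_lt_trans _ _ (lebesgue_rV R n box)).
  apply: le_measure; rewrite ?inE//; first exact: measurable_annulus.
  move=> x /andP[_ xr] i /=; rewrite in_itv/= -ler_norml.
  exact: le_trans (mx_norm_entry_le _ _) xr.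
rewrite (lebesgue_rV_box (A := fun=> `[- r, r]%classic))//.
pose v : \bar R :=
  lebesgue_measure (`[- r, r]%classic : set (measurableTypeR R)).
have vE : (fine v)%:E = v.
  by rewrite fineK// /v lebesgue_measure_itv/=; case: ifP.
rewrite (eq_bigr (fun=> (fine v)%:E)) => [|i _]; last by rewrite vE.
by rewrite prodEFin ltry.
Qed.

Lemma powR_bounded (p q c : R) : 0 < p ->
  exists B, forall s, p <= s <= q -> (s `^ c)^-1 <= B.
Proof.
move=> p0.
(* the two summands are the values at the ends, one for each sign of c *)
exists ((p `^ c)^-1 + q `^ (- c)) => s /andP[ps sq].
have s0 := lt_le_trans p0 ps.
have [c0|c0] := leP 0 c.
  apply: (@le_trans _ _ (p `^ c)^-1); last by rewrite lerDl powR_ge0.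
  rewrite lef_pV2 ?posrE ?powR_gt0//.
  by apply: ge0_ler_powR; rewrite ?nnegrE// ltW.
apply: (@le_trans _ _ (q `^ (- c))); last by rewrite lerDr invr_ge0 powR_ge0.
rewrite -powRN; apply: ge0_ler_powR; rewrite ?nnegrE ?oppr_ge0 ?(ltW c0)//.
  exact: ltW.
exact: le_trans (ltW s0) sq.
Qed.

End annular.

Definition gauge_weight (R : realType) (n : nat) (K : set 'rV[R]_n) (c : R)
    (x : 'rV[R]_n) : R :=
  (mink K x `^ c)^-1.

Local Notation gauge_integral K c f :=
  (\int[lebesgue_rV _ _]_x (f x * gauge_weight K c x)).

Section gauge_weight.
Context {R : realType} {n : nat} {K : set 'rV[R]_n}.
Hypotheses (K0 : nbhs (0 : 'rV[R]_n) K) (bK : bounded_set K).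
Hypothesis cK : @convex_set R 'rV[R]_n K.
Implicit Types (x : 'rV[R]_n) (c t : R) (f : 'rV[R]_n -> R).

Lemma mink_gt0 x : x != 0 -> 0 < mink K x.
Proof.
have [M M0 MP] := mink_norm_ge K0 bK.
by rewrite -normr_gt0 => /lt_le_trans/(_ (MP x)); rewrite pmulr_rgt0.
Qed.

Lemma gauge_weight_ge0 c x : 0 <= gauge_weight K c x.
Proof. by rewrite invr_ge0 powR_ge0. Qed.

Lemma measurable_gauge_weight c : measurable_fun setT (gauge_weight K c).
Proof.
rewrite (_ : gauge_weight K c = (fun r : R => r `^ (- c)) \o mink K).
  apply: measurableT_comp => //; apply: continuous_measurable_rV.
  exact: continuous_mink.
by apply/funext => x; rewrite /= powRN.
Qed.

Lemma gauge_weightZ c t x : 0 < t ->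
  gauge_weight K c (t *: x) = t `^ (- c) * gauge_weight K c x.
Proof.
move=> t0; rewrite /gauge_weight minkZ// powRM ?mink_ge0 ?(ltW t0)//.
by rewrite invfM powRN.
Qed.

Lemma gauge_weight_bounded c (d r : R) : 0 < d ->
  exists B, forall x, annulus d r x -> gauge_weight K c x <= B.
Proof.
move=> d0; have [M M0 MP] := mink_norm_ge K0 bK.
have [m m0 mP] := mink_le_norm K0.
have [|B BP] := @powR_bounded R (M^-1 * d) (m * r) c.
  by rewrite mulr_gt0 ?invr_gt0.
exists B => x /andP[dx xr]; apply: BP; apply/andP; split.
  by rewrite ler_pdivrMl// (le_trans dx).
by rewrite (le_trans (mP x))// ler_wpM2l// ltW.
Qed.

Lemma integrable_gauge_weight c f : annular f ->
  (lebesgue_rV R n).-integrable setT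
    (EFin \o (fun x => f x * gauge_weight K c x)).
Proof.
move=> [mf [d [r [M [d0 fM fdr]]]]].
have [B BP] := gauge_weight_bounded c r d0.
have mfw : measurable_fun setT (fun x => f x * gauge_weight K c x).
  by apply: measurable_funM => //; exact: measurable_gauge_weight.
have -> : EFin \o (fun x => f x * gauge_weight K c x) =
    (EFin \o (fun x => f x * gauge_weight K c x)) \_ (annulus d r).
  apply/funext => x; rewrite patchE; case: ifPn => // /negP xdr /=.
  have [->|/fdr fx] := eqVneq (f x) 0; first by rewrite mul0r.
  by case: xdr; rewrite inE.
apply/(integrable_mkcond _ (measurable_annulus _ _)).
apply: measurable_bounded_integrable.
- exact: measurable_annulus.
- exact: lebesgue_annulus_lty.
- exact: measurable_funTS.
exists (M * B); split; first exact: num_real.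
move=> y yMB x /= xdr; rewrite (le_trans _ (ltW yMB))// normrM ler_pM//.
by rewrite ger0_norm ?gauge_weight_ge0// BP.
Qed.

End gauge_weight.

(** * The radial identity *)

Section test_functions.
Context {R : realType} {n : nat}.
Implicit Types (u f : 'rV[R]_n -> R).

Definition euler u (x : 'rV[R]_n) : R := dot (grad u x) x.

Lemma eulerE u x : euler u x = \sum_(i < n) partial i u x * x ord0 i.
Proof. by rewrite /euler /dot; apply: eq_bigr => i _; rewrite mxE. Qed.

Lemma annular_of_tsupport u f : compact (tsupport u) -> ~ tsupport u 0 ->
  continuous f -> (forall x, f x != 0 -> tsupport u x) -> annular f.
Proof.
move=> cS S0 cf fS; split; first exact: continuous_measurable_rV.
have /nbhs_ballP[d /= d0 dS] : nbhs (0 : 'rV[R]_n) (~` tsupport u).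
  by apply: open_nbhs_nbhs; split => //; apply/closed_openC/closed_closure.
have /ex_strict_bound_gt0[r r0 Sr] := compact_bounded cS.
have /ex_strict_bound_gt0[M M0 fM] : bounded_set (f @` tsupport u).
  apply/compact_bounded/continuous_compact => //.
  exact: continuous_subspaceT.
exists d, r, M; split => // x.
  have [->|/fS Sx] := eqVneq (f x) 0; first by rewrite normr0 ltW.
  by apply/ltW/fM; exists x.
move=> /fS Sx; apply/andP; split; last exact/ltW/Sr.
rewrite leNgt; apply/negP => xd; apply: (dS x) Sx.
by rewrite -ball_normE /ball_/= sub0r normrN.
Qed.

Lemma partial_tsupport u i x : partial i u x != 0 -> tsupport u x.
Proof.
apply: contra_neqP => Sx.
have u0 : \near x, u x = cst 0 x.
  have : nbhs x (~` tsupport u).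
    by apply: open_nbhs_nbhs; split => //; apply/closed_openC/closed_closure.
  apply: filterS => y Sy; apply/eqP/negPn/negP => uy.
  by apply: Sy; exact: subset_closure.
by rewrite /partial (near_eq_derive _ u0) derive_cst.
Qed.

Context {u : 'rV[R]_n -> R}.
Hypothesis hu : Ccinfty_off0 u.

Lemma Ccinfty_derivable i x : derivable u x (delta_mx ord0 i).
Proof. by have [/(_ [::])[_ du] _ _] := hu; exact: du. Qed.

Lemma Ccinfty_continuous : continuous u.
Proof. by have [/(_ [::])[cu _] _ _] := hu; exact: cu. Qed.

Lemma Ccinfty_continuous_partial i : continuous (partial i u).
Proof. by have [/(_ [:: i])[cu _] _ _] := hu; exact: cu. Qed.

Lemma annular_Ccinfty : annular u.
Proof.
have [_ cS S0] := hu.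
apply: annular_of_tsupport cS S0 Ccinfty_continuous _ => x ux.
exact: subset_closure.
Qed.

Lemma annular_euler : annular (euler u).
Proof.
have [_ cS S0] := hu; apply: annular_of_tsupport cS S0 _ _.
  rewrite (_ : euler u = fun x => \sum_(i < n) partial i u x * x ord0 i).
    apply: continuous_big => [|i _ x]; first exact: add_continuous.
    apply: (@cvgM _ _ (nbhs x)); last exact: coord_continuous.
    exact: Ccinfty_continuous_partial.
  by apply/funext => x; rewrite eulerE.
move=> x; apply: contra_neqP => Sx; rewrite eulerE big1// => i _.
have [->|/partial_tsupport//] := eqVneq (partial i u x) 0.
by rewrite mul0r.
Qed.

Lemma is_derive_ray (x : 'rV[R]_n) (t : R) : t != 0 ->
  is_derive t 1 (fun s : R => u (s *: x)) (t^-1 * euler u (t *: x)).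
Proof.
move=> t0; have [dx Dx] :=
  @is_derive_dot_grad R n u (t *: x) x Ccinfty_derivable
    Ccinfty_continuous_partial.
have := @is_derive_line R _ u 0 x t; rewrite addr0 Dx => /(_ dx).
under eq_fun do rewrite addr0.
move=> D; apply: is_derive_eq D _; rewrite /euler /dot mulr_sumr.
by apply: eq_bigr => i _; rewrite !mxE mulrCA mulKf.
Qed.

Context {K : set 'rV[R]_n}.
Hypotheses (K0 : nbhs (0 : 'rV[R]_n) K) (bK : bounded_set K).
Hypothesis cK : @convex_set R 'rV[R]_n K.

Lemma annular_dilation (f : 'rV[R]_n -> R) (t : R) : 0 < t ->
  annular f -> annular (fun x => f (t *: x)).
Proof.
move=> t0 [mf [d [r [M [d0 fM fdr]]]]]; split.
  by apply: measurableT_comp => //; exact: measurable_rV_dilation.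
exists (t^-1 * d), (t^-1 * r), M; split => // [|x /fdr].
  by rewrite mulr_gt0 ?invr_gt0.
by rewrite normrZ gtr0_norm// ler_pdivrMl// ler_pdivlMl.
Qed.

(** With [g = u^2 r^(-c)], homogeneity of [r] gives
    [u(t x)^2 r(x)^(-c) = t^c g(t x)], and the substitution contributes the
    Jacobian [t^(-n)]. *)
Lemma gauge_integral_dilation c t : 0 < t ->
  gauge_integral K c (fun x => u (t *: x) ^+ 2) =
  t `^ (c - n%:R) * gauge_integral K c (fun x => u x ^+ 2).
Proof.
move=> t0; pose g x := u x ^+ 2 * gauge_weight K c x.
have mg : measurable_fun setT g.
  apply: measurable_funM; last exact: measurable_gauge_weight.
  by apply: measurable_funX; exact: annular_Ccinfty.1.
have g0 x : 0 <= g x by rewrite mulr_ge0 ?sqr_ge0 ?gauge_weight_ge0.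
have E : \int[lebesgue_rV R n]_x g x =
    t ^+ n * \int[lebesgue_rV R n]_x g (t *: x).
  rewrite /Rintegral.
  rewrite -(@integral_rV_dilation R n (PosNum t0) (EFin \o g))//=; last first.
    exact: measurableT_comp.
  have tn0 : 0 < t ^+ n by rewrite exprn_gt0.
  case: (integral _ _ _) => [r||]//=.
    by rewrite gt0_muley ?lte_fin//= mulr0.
  by rewrite gt0_muleNy ?lte_fin//= mulr0.
have gt x : g (t *: x) = t `^ (- c) * (u (t *: x) ^+ 2 * gauge_weight K c x).
  by rewrite /g gauge_weightZ// mulrCA.
rewrite [X in _ = _ * X]E; under [in RHS]eq_Rintegral do rewrite gt.
rewrite RintegralZl//; last first.
  have ut := annular_dilation t0 annular_Ccinfty.
  exact: (integrable_gauge_weight K0 bK cK c (annularM ut ut)).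
rewrite powRB ?(gt_eqF t0) ?implybT// powRN powR_mulrn ?ltW//.
by rewrite mulrA divfK ?gt_eqF ?exprn_gt0// mulVKf// gt_eqF// powR_gt0.
Qed.

(** Derivative at [t = 1] of both sides of the previous lemma. For [t] between
    1/2 and 2 the [t]-derivative of the integrand vanishes off a fixed annulus
    and is bounded there by a multiple of the weight, which allows
    differentiation under the integral sign. *)
Lemma radial_identity c :
  2 * gauge_integral K c (fun x => u x * euler u x) =
  (c - n%:R) * gauge_integral K c (fun x => u x ^+ 2).
Proof.
pose f (t : R) (x : 'rV[R]_n) : R := u (t *: x) ^+ 2 * gauge_weight K c x.
have [_ [d [r [M [d0 uEM uEdr]]]]] := annularM annular_Ccinfty annular_euler.
have M0 : 0 <= M by exact: le_trans (normr_ge0 _) (uEM 0).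
(* d/dt u(t x)^2 = (2 / t) (u E u)(t x), where 2 / t <= 4 *)
pose G x := 4 * M * \1_(annulus (2^-1 * d) (2 * r)) x * gauge_weight K c x.
have df (t : R) (x : 'rV[R]_n) : 0 < t -> is_derive t 1 (f ^~ x)
    (2 * t^-1 * (u (t *: x) * euler u (t *: x)) * gauge_weight K c x).
  move=> t0; have D := is_derive_ray x (lt0r_neq0 t0).
  have D2 := is_deriveX 2 D.
  have -> : f ^~ x = gauge_weight K c x \*: (fun s : R => u (s *: x)) ^+ 2.
    by apply/funext => s; rewrite /f mulrC.
  apply: is_derive_eq (is_deriveZ (gauge_weight K c x) D2) _.
  by rewrite /= expr1 /GRing.scale/=; ring.
have I1 : (`]2^-1, 2[%classic : set R) 1.
  rewrite /= in_itv/=; lra.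
have Ipos (t : R) : `]2^-1, 2[%classic t -> 0 < t.
  by rewrite /= in_itv/= => /andP[/(lt_trans _)->]//; rewrite invr_gt0.
have d1f (t : R) (x : 'rV[R]_n) : 0 < t -> partial1of2 f t x =
    2 * t^-1 * (u (t *: x) * euler u (t *: x)) * gauge_weight K c x.
  by move=> t0; rewrite partial1of2E; have [_] := df t x t0.
have G0 x : 0 <= G x.
  by rewrite /G mulr_ge0 ?gauge_weight_ge0// !mulr_ge0.
have intG : (lebesgue_rV R n).-integrable setT (EFin \o G).
  apply: (integrable_gauge_weight K0 bK cK c); split.
    apply: measurable_funM => //; apply: measurable_indic.
    exact: measurable_annulus.
  exists (2^-1 * d), (2 * r), (4 * M); split => [|x|x].
      by rewrite mulr_gt0.
    rewrite normrM (ger0_norm (mulr_ge0 _ M0))// indicE.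
    by case: (x \in _); rewrite ?normr1 ?mulr1// normr0 mulr0 mulr_ge0.
  rewrite indicE; case: (boolP (x \in _)) => [|_]; last by rewrite mulr0 eqxx.
  by rewrite inE.
have intf (t : R) : `]2^-1, 2[%classic t ->
    (lebesgue_rV R n).-integrable setT (EFin \o f t).
  move=> /Ipos t0; have ut := annular_dilation t0 annular_Ccinfty.
  exact: (integrable_gauge_weight K0 bK cK c (annularM ut ut)).
have derf (t : R) (x : 'rV[R]_n) : `]2^-1, 2[%classic t -> setT x ->
    derivable (f ^~ x) t 1.
  by move=> /Ipos t0 _; case: (df t x t0).
have G_ub (t : R) (x : 'rV[R]_n) : `]2^-1, 2[%classic t -> setT x ->
    `|partial1of2 f t x| <= G x.
  move=> It _; have t0 := Ipos t It; rewrite d1f// normrM.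
  rewrite (ger0_norm (gauge_weight_ge0 _ _)) /G ler_wpM2r ?gauge_weight_ge0//.
  move: It; rewrite /= in_itv/= => /andP[t12 t2].
  have t2' : t^-1 <= 2 by rewrite -[leRHS]invrK lef_pV2 ?posrE ?invr_gt0// ltW.
  rewrite normrM (ger0_norm (mulr_ge0 _ _)) ?invr_ge0 ?(ltW t0)// indicE.
  have [z|/uEdr] := eqVneq (u (t *: x) * euler u (t *: x)) 0.
    by rewrite z normr0 mulr0 !mulr_ge0.
  rewrite normrZ gtr0_norm// => /andP[dtx txr].
  rewrite mem_set ?mulr1; last first.
    rewrite /annulus/=; apply/andP; split.
      rewrite ler_pdivrMl// (le_trans dtx)// ler_wpM2r// ltW//.
    rewrite -ler_pdivrMl//; apply: le_trans txr.
    by rewrite ler_wpM2r// ltW.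
  by apply: ler_pM (uEM _); rewrite ?mulr_ge0 ?invr_ge0 ?(ltW t0)//; lra.
have := differentiation_under_integral measurableT I1 intf derf G0 intG G_ub.
have -> : derive1 (fun t => \int[lebesgue_rV R n]_x f t x) 1 =
    (c - n%:R) * gauge_integral K c (fun x => u x ^+ 2).
  rewrite derive1E.
  rewrite (@near_eq_derive _ _ _ _ (gauge_integral K c (fun x => u x ^+ 2) \*:
    (@powR R ^~ (c - n%:R)))).
    have [_ ->] := is_deriveZ (gauge_integral K c (fun x => u x ^+ 2))
      (is_derive1_powR (c - n%:R) (@ltr01 R)).
    by rewrite powR1 mulr1 [_ *: _]mulrC.
  near=> t; rewrite gauge_integral_dilation; first by rewrite mulrC.
  by near: t; exact: lt_nbhsr.
move=> ->.
rewrite -RintegralZl//; last first.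
  have uE := annularM annular_Ccinfty annular_euler.
  exact: (integrable_gauge_weight K0 bK cK c uE).
by apply: eq_Rintegral => x _; rewrite d1f// scale1r invr1 mulr1 mulrA.
Unshelve. all: by end_near. Qed.

End test_functions.

(** * The Caffarelli-Kohn-Nirenberg inequalities *)

Lemma discriminant_le (R : realFieldType) (X Y E : R) : 0 <= Y ->
  (forall l, 0 <= X + l * E + l ^+ 2 * Y) -> E ^+ 2 <= 4 * (X * Y).
Proof.
rewrite le_eqVlt => /predU1P[<- H|Y0 H].
  have [->|E0] := eqVneq E 0; first by rewrite expr0n !mulr0.
  (* without quadratic term, this l makes the affine function equal to -1 *)
  have := H (- (X + 1) / E); rewrite mulr0 addr0 divfK//; lra.
have := H (- E / (2 * Y)).
have -> : X + - E / (2 * Y) * E + (- E / (2 * Y)) ^+ 2 * Y =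
    (4 * (X * Y) - E ^+ 2) / (4 * Y) by field; rewrite gt_eqF.
by rewrite pmulr_lge0 ?subr_ge0// invr_gt0 mulr_gt0.
Qed.

Lemma RintegralDZ d (T : measurableType d) (R : realType)
    (mu : {measure set T -> \bar R}) (f g : T -> R) (k : R) :
  mu.-integrable setT (EFin \o f) -> mu.-integrable setT (EFin \o g) ->
  mu.-integrable setT (EFin \o (fun x => f x + k * g x)) /\
  \int[mu]_x (f x + k * g x) = \int[mu]_x f x + k * \int[mu]_x g x.
Proof.
move=> fi gi.
have kgi : mu.-integrable setT (EFin \o (fun x => k * g x)).
  exact: (integrableZl measurableT k gi).
split; last by rewrite RintegralD// RintegralZl.
exact: (integrableD measurableT fi kgi).
Qed.

(** Nonnegative integrals are suprema over the simple functions below, so they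
    compare pointwise. *)
Lemma ge0_le_integral_no_meas d (T : measurableType d) (R : realType)
    (mu : {measure set T -> \bar R}) (f g : T -> \bar R) :
  (forall x, 0 <= f x)%E -> (forall x, f x <= g x)%E ->
  (\int[mu]_x f x <= \int[mu]_x g x)%E.
Proof.
move=> f0 fg; rewrite !ge0_integralTE//; last first.
  by move=> x; exact: le_trans (f0 x) (fg x).
apply: ereal_sup_le => _ [h /= hf <-]; exists h => //= x.
exact: le_trans (hf x) (fg x).
Qed.

Section ckn.
Context {R : realType} {n : nat} {u : 'rV[R]_n -> R} {K : set 'rV[R]_n}.
Hypotheses (hu : Ccinfty_off0 u) (K0 : nbhs (0 : 'rV[R]_n) K).
Hypotheses (bK : bounded_set K) (cK : @convex_set R 'rV[R]_n K).

Lemma gauge_weightD c c' x : x != 0 ->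
  gauge_weight K (c + c') x = gauge_weight K c x * gauge_weight K c' x.
Proof.
move=> x0; rewrite /gauge_weight powRD ?invfM//.
by rewrite (gt_eqF (mink_gt0 K0 bK x0)) implybT.
Qed.

Lemma annular0 (f : 'rV[R]_n -> R) : annular f -> f 0 = 0.
Proof.
move=> [_ [d [r [M [d0 _ fdr]]]]]; apply/eqP/negPn/negP => /fdr.
by rewrite normr0 => /andP[/(lt_le_trans d0)]; rewrite ltxx.
Qed.

(** This is the integral of [((E u - k u) r^(-b-1) + l u r^(-a))^2], expanded,
    with the integrals of [u (E u)] replaced through [radial_identity]. *)
Lemma radial_quadratic_form_ge0 a b k l :
  0 <= gauge_integral K (2 * b + 2) (fun x => euler u x ^+ 2)
       - k * (2 * b + 2 - n%:R - k) *
         gauge_integral K (2 * b + 2) (fun x => u x ^+ 2)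
       + l * (a + b + 1 - n%:R - 2 * k) *
         gauge_integral K (a + b + 1) (fun x => u x ^+ 2)
       + l ^+ 2 * gauge_integral K (2 * a) (fun x => u x ^+ 2).
Proof.
have au := annular_Ccinfty hu; have aE := annular_euler hu.
have iEE := integrable_gauge_weight K0 bK cK (2 * b + 2) (annularM aE aE).
have iuu c := integrable_gauge_weight K0 bK cK c (annularM au au).
have iuE c := integrable_gauge_weight K0 bK cK c (annularM au aE).
have [i1 E1] := RintegralDZ (- (2 * k)) iEE (iuE (2 * b + 2)).
have [i2 E2] := RintegralDZ (k ^+ 2) i1 (iuu (2 * b + 2)).
have [i3 E3] := RintegralDZ (2 * l) i2 (iuE (a + b + 1)).
have [i4 E4] := RintegralDZ (- (2 * l * k)) i3 (iuu (a + b + 1)).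
have [i5 E5] := RintegralDZ (l ^+ 2) i4 (iuu (2 * a)).
have rad c := radial_identity hu K0 bK cK c.
set S := (X in 0 <= X).
have -> : S = \int[lebesgue_rV R n]_x
   (euler u x * euler u x * gauge_weight K (2 * b + 2) x
    + - (2 * k) * (u x * euler u x * gauge_weight K (2 * b + 2) x)
    + k ^+ 2 * (u x * u x * gauge_weight K (2 * b + 2) x)
    + 2 * l * (u x * euler u x * gauge_weight K (a + b + 1) x)
    + - (2 * l * k) * (u x * u x * gauge_weight K (a + b + 1) x)
    + l ^+ 2 * (u x * u x * gauge_weight K (2 * a) x)).
  rewrite E5 E4 E3 E2 E1.
  have := rad (2 * b + 2); have := rad (a + b + 1).
  rewrite /S => r1 r2.
  rewrite [2 * l]mulrC.
  rewrite -[l * 2 * _]mulrA r1 mulNr -[2 * k * _]mulrA.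
  rewrite [k * (\int[_]_x _)]mulrC [2 * (_ * k)]mulrA r2.
  ring.
apply: Rintegral_ge0 => x _.
have [->|x0] := eqVneq x 0.
  by rewrite (annular0 au) (annular0 aE) !(mul0r, mulr0, addr0).
have -> : 2 * b + 2 = (b + 1) + (b + 1) by ring.
have -> : a + b + 1 = a + (b + 1) by ring.
have -> : 2 * a = a + a by ring.
rewrite (gauge_weightD (b + 1) (b + 1))// (gauge_weightD a (b + 1))//.
rewrite (gauge_weightD a a)//.
set p := gauge_weight K (b + 1) x; set q := gauge_weight K a x.
apply: le_trans (sqr_ge0 ((euler u x - k * u x) * p + l * (u x * q))) _.
by rewrite le_eqVlt; apply/orP; left; apply/eqP; ring.
Qed.

Lemma weighted_squareE c :
  weighted_square K u c = (gauge_integral K c (fun x => u x ^+ 2))%:E.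
Proof.
have au := annular_Ccinfty hu.
rewrite /Rintegral fineK//; apply: integrable_fin_num => //.
exact: integrable_gauge_weight (annularM au au).
Qed.

(** The maximum accounts for a body that is not symmetric: the sign of [E u]
    decides which of [grad u] and [- grad u] bounds its absolute value. *)
Lemma euler_sqr_le x : euler u x ^+ 2 <=
  Num.max (mink (polar K) (grad u x) ^+ 2) (mink (polar K) (- grad u x) ^+ 2)
  * mink K x ^+ 2.
Proof.
have h := dot_le_mink_polar K0 bK.
have dotN : dot (- grad u x) x = - euler u x.
  by rewrite /euler /dot -sumrN; apply: eq_bigr => i _; rewrite !mxE mulNr.
have [E0|E0] := leP 0 (euler u x).
  apply: (@le_trans _ _ (mink (polar K) (grad u x) ^+ 2 * mink K x ^+ 2)).
    by rewrite -exprMn lerXn2r ?nnegrE ?mulr_ge0 ?mink_ge0// h.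
  by rewrite ler_wpM2r ?sqr_ge0// le_max lexx.
apply: (@le_trans _ _ (mink (polar K) (- grad u x) ^+ 2 * mink K x ^+ 2)).
  rewrite -exprMn -sqrrN.
  rewrite lerXn2r ?nnegrE ?mulr_ge0 ?mink_ge0 ?oppr_ge0 ?(ltW E0)//.
  by rewrite -dotN h.
by rewrite ler_wpM2r ?sqr_ge0// le_max lexx orbT.
Qed.

Lemma gradient_term_ge b :
  ((gauge_integral K (2 * b + 2) (fun x => euler u x ^+ 2))%:E <=
   gradient_term K u b)%E.
Proof.
have aE := annular_euler hu.
have iE := integrable_gauge_weight K0 bK cK (2 * b + 2) (annularM aE aE).
rewrite /Rintegral fineK; last exact: integrable_fin_num.
apply: ge0_le_integral_no_meas => x; rewrite lee_fin.
  by rewrite mulr_ge0 ?sqr_ge0 ?gauge_weight_ge0.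
have [->|x0] := eqVneq x 0.
  rewrite (annular0 aE) expr0n mul0r divr_ge0 ?powR_ge0//.
  by rewrite le_max sqr_ge0.
rewrite gauge_weightD// mulrCA mulrC ler_wpM2r ?invr_ge0 ?powR_ge0//.
rewrite /gauge_weight powR_mulrn ?mink_ge0//.
by rewrite ler_pdivrMr ?exprn_gt0 ?mink_gt0// euler_sqr_le.
Qed.

(** Under the condition on [k] the quadratic form in [l] involves only the three
    integrals of the statement: its values at [1] and [-1] give the first bound,
    its discriminant the second. *)
Lemma ckn_of_annihilating_shift a b k : k * (2 * b + 2 - n%:R - k) = 0 ->
  let D := a + b + 1 - n%:R - 2 * k in
  (gradient_term K u b + weighted_square K u (2 * a) >=
     `|D|%:E * weighted_square K u (a + b + 1))%E /\
  (gradient_term K u b `^ 2^-1 * weighted_square K u (2 * a) `^ 2^-1 >=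
     (`|D| / 2)%:E * weighted_square K u (a + b + 1))%E.
Proof.
move=> k0 D; have G := gradient_term_ge b.
have Q l := radial_quadratic_form_ge0 a b k l.
rewrite !weighted_squareE.
move: G Q; rewrite k0 -/D.
set X := gauge_integral K (2 * b + 2) (fun x => euler u x ^+ 2).
set Y := gauge_integral K (2 * a) (fun x => u x ^+ 2).
set Z := gauge_integral K (a + b + 1) (fun x => u x ^+ 2) => G Q.
have J0 c (f : 'rV[R]_n -> R) : 0 <= gauge_integral K c (fun x => f x ^+ 2).
  apply: Rintegral_ge0 => x _.
  by rewrite mulr_ge0 ?sqr_ge0 ?gauge_weight_ge0.
have [X0 Y0 Z0] : [/\ 0 <= X, 0 <= Y & 0 <= Z] by split; exact: J0.
have {}Q l : 0 <= X + l * (D * Z) + l ^+ 2 * Y.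
  by have := Q l; rewrite mul0r subr0 mulrA.
split.
  apply: le_trans (leeD G (lexx _)); rewrite -EFinM -EFinD lee_fin.
  have := Q 1; have := Q (-1); rewrite sqrrN expr1n !mul1r.
  by case: (ger0P D) => _; lra.
have EX : (X%:E `^ 2^-1 = (Num.sqrt X)%:E)%E.
  by rewrite poweR_EFin powR12_sqrt.
have EY : (Y%:E `^ 2^-1 = (Num.sqrt Y)%:E)%E.
  by rewrite poweR_EFin powR12_sqrt.
rewrite EY; apply: (@le_trans _ _ ((Num.sqrt X)%:E * (Num.sqrt Y)%:E)%E).
  rewrite -!EFinM lee_fin -sqrtrM//.
  apply: le_trans (ler_norm _) _; rewrite -sqrtr_sqr ler_wsqrtr//.
  have := discriminant_le Y0 Q.
  suff -> : (`|D| / 2 * Z) ^+ 2 = (D * Z) ^+ 2 / 4.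
    by rewrite ler_pdivrMr// (mulrC _ 4).
  by rewrite !exprMn -normrX ger0_norm ?sqr_ge0//; field.
rewrite lee_wpmul2r ?lee_fin ?sqrtr_ge0// -EX.
apply: gt0_ler_poweR => //; rewrite in_itv/= leey andbT ?lee_fin//.
by apply: le_trans G; rewrite lee_fin.
Qed.

(** The constant is the maximum of [k (2b+2-n-k)] over [k], which bounds the
    quadratic form at [l = 0]. *)
Lemma hardy b :
  (gradient_term K u b >= ((n%:R - 2 * b - 2) ^+ 2 / 4)%:E *
     weighted_square K u (2 * b + 2))%E.
Proof.
apply: le_trans (gradient_term_ge b); rewrite weighted_squareE -EFinM lee_fin.
rewrite (_ : (n%:R - 2 * b - 2) ^+ 2 / 4 = (2 * b + 2 - n%:R) / 2 *
    (2 * b + 2 - n%:R - (2 * b + 2 - n%:R) / 2)); last by field.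
have := radial_quadratic_form_ge0 (b + 1) b ((2 * b + 2 - n%:R) / 2) 0.
by rewrite expr0n/= !mul0r !addr0 subr_ge0.
Qed.

End ckn.

Unset Implicit Arguments.
Set Strict Implicit.
Set Printing Implicit Defensive.

Theorem theorem5p2 (R : realType) (N : nat) (hN : (2 <= N)%N)
    (K : set 'rV[R]_N) (hK : Kss_o K)
    (u : 'rV[R]_N -> R) (hu : Ccinfty_off0 u) (a b : R) :
  (gradient_term K u b + weighted_square K u (2 * a) >=
     (C_ckn1 N a b)%:E * weighted_square K u (a + b + 1))%E
  /\
  (gradient_term K u b `^ 2^-1 * weighted_square K u (2 * a) `^ 2^-1 >=
     (C_ckn2 N a b)%:E * weighted_square K u (a + b + 1))%E.
Proof.
have [[/compact_bounded bK cK _] K0 _ _] := hK.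
have A := @ckn_of_annihilating_shift R N u K hu K0 bK cK a b 0.
have B :=
  @ckn_of_annihilating_shift R N u K hu K0 bK cK a b (2 * b + 2 - N%:R).
move: A B; rewrite mul0r mulr0 subr0 subrr mulr0.
move=> /(_ erefl)/= A /(_ erefl)/= B.
have EA : `|a + b + 1 - N%:R| = `|N%:R - a - b - 1|.
  by rewrite distrC; congr `|_|; ring.
have EB : `|a + b + 1 - N%:R - 2 * (2 * b + 2 - N%:R)| =
    `|N%:R - 3 * b + a - 3|.
  by congr `|_|; ring.
move: A B; rewrite EA EB => A B.
rewrite /C_ckn1 /C_ckn2 !normrM (ger0_norm (_ : 0 <= 2^-1 :> R))//.
case: ifPn => [_|nA]; first exact: A.
case: ifPn => [_|nB]; first exact: B.
have ab : a = b + 1.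
  apply/eqP; apply: contraT => /(@regionAB R N).
  by rewrite (negbTE nA) (negbTE nB).
rewrite ab in A *; have -> : b + 1 + b + 1 = 2 * b + 2 by ring.
have b2 : 2 * (b + 1) = 2 * b + 2 by ring.
split; last first.
  move: A.2; rewrite (_ : b + 1 + b + 1 = 2 * b + 2); last ring.
  by rewrite (_ : N%:R - (b + 1) - b - 1 = N%:R - 2 * (b + 1)); last ring.
rewrite b2 EFinD ge0_muleDl ?lee_fin ?divr_ge0 ?sqr_ge0//.
by rewrite mul1e addeC leeD2r// hardy.
Qed.
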